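(* Let $X$ be a Fréchet space and let $\Gamma:[0,1]\to ck(X)$ be Bochner measurable and Pettis integrable in $ck(X)$. Then for each Lebesgue measurable $E\subseteq[0,1]$, $$(P)\int_E\Gamma(t)dt=\Big\{(P)\int_Ef(t)dt:\ f\text{ a Pettis integrable selection of }\Gamma\Big\}.$$
   Context: $X$ is a Fréchet space with metric $d$ induced by an increasing sufficient sequence of seminorms; $X^*$ its dual. $ck(X)$ (resp. $cb(X)$): nonempty compact (resp. closed bounded) convex subsets; $H$ the Hausdorff metric from $d$. $\sigma(x^*,C)=\sup_{x\in C}\langle x^*,x\rangle$. Bochner measurable: there are simple multifunctions $\sum_j\chi_{A_j}C_j$ ($A_j$ pairwise disjoint measurable, $C_j\in cb(X)$) converging to $\Gamma(t)$ in $H$ for a.e. $t$. Pettis integrable in $ck(X)$: $\sigma(x^*,\Gamma(\cdot))$ Lebesgue integrable for all $x^*$ and for each measurable $E$ there is $(P)\int_E\Gamma\in ck(X)$ with $\sigma(x^*,(P)\int_E\Gamma)=\int_E\sigma(x^*,\Gamma(t))dt$ for all $x^*$. A selection is $f:[0,1]\to X$ with $f(t)\in\Gamma(t)$ a.e.; $f$ is Pettis integrable if $\langle x^*,f\rangle$ is integrable for all $x^*$ and for each measurable $E$ there is $(P)\int_Ef\in X$ with $\langle x^*,(P)\int_Ef\rangle=\int_E\langle x^*,f\rangle dt$ for all $x^*$. *)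

(* Defs.v *)
From mathcomp Require Import all_boot all_algebra all_classical all_reals all_analysis.
Import GRing.Theory Num.Theory.
Set Implicit Arguments. Unset Strict Implicit. Unset Printing Implicit Defensive.
Local Open Scope classical_set_scope.
Local Open Scope ring_scope.

(* The measurable type carrying Lebesgue (= completed) measurable sets of R. *)
Definition lebT (R : realType) : Type :=
  ltac:(let t := type of (@completed_lebesgue_measure R) in
        match t with set ?A -> _ => exact A end).
Definition leb {R : realType} : set (lebT R) -> \bar R := @completed_lebesgue_measure R.

Section Frechet.
Context {R : realType} {X : lmodType R}.

Definition seminorm (q : X -> R) :=
  (forall x y, q (x + y) <= q x + q y) /\ (forall (a : R) x, q (a *: x) = `|a| * q x).

Definition fdist (p : nat -> X -> R) (x y : X) : R :=
  sup [set \sum_(n < N) ((2%:R ^- n) * Num.min 1 (p n (x - y))) | N in [set: nat]].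

Definition fcauchy (p : nat -> X -> R) (u : nat -> X) := forall e : R, 0 < e ->
  exists N, forall m n, (N <= m)%N -> (N <= n)%N -> fdist p (u m) (u n) < e.

Definition fconverges (p : nat -> X -> R) (u : nat -> X) (x : X) := forall e : R, 0 < e ->
  exists N, forall n, (N <= n)%N -> fdist p (u n) x < e.

Definition frechet_seminorms (p : nat -> X -> R) :=
  [/\ forall n, seminorm (p n),
      forall n x, p n x <= p n.+1 x,
      forall x, (forall n, p n x = 0) -> x = 0 &
      forall u, fcauchy p u -> exists x, fconverges p u x].

Definition fdual (p : nat -> X -> R) (f : X -> R) :=
  (forall (a : R) x y, f (a *: x + y) = a * f x + f y) /\
  (forall x (e : R), 0 < e -> exists2 del : R, 0 < del &
      forall y, fdist p x y < del -> `|f x - f y| < e).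

Definition fopen (p : nat -> X -> R) (U : set X) :=
  forall x, U x -> exists2 r : R, 0 < r & forall y, fdist p x y < r -> U y.

Definition fclosed (p : nat -> X -> R) (C : set X) := fopen p (~` C).

Definition fcompact (p : nat -> X -> R) (C : set X) :=
  forall (I : Type) (U : I -> set X), (forall i, fopen p (U i)) ->
    C `<=` \bigcup_i U i ->
    exists (m : nat) (s : 'I_m -> I), C `<=` \bigcup_k U (s k).

Definition fbounded (p : nat -> X -> R) (C : set X) :=
  forall n, exists M : R, forall x, C x -> p n x <= M.

Definition fconvex (C : set X) := forall x y (l : R), C x -> C y ->
  0 <= l <= 1 -> C (l *: x + (1 - l) *: y).

Definition ck (p : nat -> X -> R) (C : set X) := [/\ C !=set0, fcompact p C & fconvex C].
Definition cb (p : nat -> X -> R) (C : set X) := [/\ C !=set0, fclosed p C, fbounded p C & fconvex C].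

Definition pt_dist (p : nat -> X -> R) (x : X) (B : set X) : R := inf [set fdist p x b | b in B].
Definition hausdorff (p : nat -> X -> R) (A B : set X) : R :=
  Num.max (sup [set pt_dist p a B | a in A]) (sup [set pt_dist p b A | b in B]).

Definition sigma (f : X -> R) (C : set X) : R := sup [set f x | x in C].

(* value at t of the simple multifunction sum_j chi_{A_j} C_j
   (A_j pairwise disjoint): C_j on A_j, {0} outside the union of the A_j *)
Definition simple_mf (n : nat) (A : 'I_n -> set (lebT R)) (C : 'I_n -> set X)
  (t : lebT R) : set X :=
  fun x => (exists i, A i t /\ C i x) \/ ((forall i, ~ A i t) /\ x = 0).

Definition bochner_measurable (p : nat -> X -> R) (G : R -> set X) :=
  exists (n : nat -> nat) (A : forall k, 'I_(n k) -> set (lebT R))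
         (C : forall k, 'I_(n k) -> set X),
  [/\ forall k i, measurable (A k i),
      forall k (i j : 'I_(n k)), i != j -> A k i `&` A k j = set0,
      forall k i, cb p (C k i) &
      {ae leb, forall t : lebT R, `[0%R, 1%R]%classic t ->
          (fun k => hausdorff p (simple_mf (A k) (C k) t) (G t)) @ \oo --> 0}].

Definition mf_pettis_integral (p : nat -> X -> R) (G : R -> set X) (E : set (lebT R)) (P : set X) :=
  ck p P /\ forall f, fdual p f ->
    (\int[leb]_(t in E) (sigma f (G t))%:E = (sigma f P)%:E)%E.

Definition mf_pettis_integrable (p : nat -> X -> R) (G : R -> set X) :=
  (forall f, fdual p f ->
     leb.-integrable (`[0%R, 1%R]%classic : set (lebT R)) (fun t => (sigma f (G t))%:E)) /\
  forall E : set (lebT R), measurable E -> E `<=` `[0%R, 1%R]%classic ->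
    exists P, mf_pettis_integral p G E P.

Definition pettis_integral (p : nat -> X -> R) (g : R -> X) (E : set (lebT R)) (x : X) :=
  forall f, fdual p f -> (\int[leb]_(t in E) (f (g t))%:E = (f x)%:E)%E.

Definition pettis_integrable (p : nat -> X -> R) (g : R -> X) :=
  (forall f, fdual p f ->
     leb.-integrable (`[0%R, 1%R]%classic : set (lebT R)) (fun t => (f (g t))%:E)) /\
  forall E : set (lebT R), measurable E -> E `<=` `[0%R, 1%R]%classic ->
    exists x, pettis_integral p g E x.

Definition selection (G : R -> set X) (g : R -> X) :=
  {ae leb, forall t : lebT R, `[0%R, 1%R]%classic t -> G t (g t)}.

End Frechet.

(* Main.v *)
(* Inclusion from right to left: an integral x of a selection satisfies
   y x <= sigma y P for all y in X*, and a least-squares argument (finitely many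
   functionals at a time, then compactness) shows that such an x lies in P.

   Conversely let x be a point of P. The functional chi_E y |-> y x is dominated
   by the sublinear functional phi |-> int sigma (phi t) (G t) on simple X*-valued
   functions. A Hahn-Banach extension yields, for each y, a finite signed measure
   nu_y with nu_y A <= int_A sigma y (G t) and nu_y E = y x; let h_y be its
   Radon-Nikodym density. For countably many y, almost every t satisfies all the
   inequalities between rational combinations of the h_y t and the support
   function of G t, so by the same least-squares argument some g t in G t has
   y (g t) = h_y t. Bochner measurability is only used to choose countably many
   functionals that separate the points of G t for almost every t; then g is
   determined by them, and y (g t) = h_y t almost everywhere for every y in X*. *)
From HB Require Import structures.
Require Import Defs.
From mathcomp Require Import all_boot all_order all_algebra all_classical all_reals all_analysis.
From mathcomp Require Import measurable_realfun ring lra.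
Import Order.TTheory GRing.Theory Num.Theory.
Set Implicit Arguments. Unset Strict Implicit. Unset Printing Implicit Defensive.
Local Open Scope classical_set_scope.
Local Open Scope ring_scope.

(** * The Hahn-Banach theorem for sublinear functionals on a subspace *)

Section HahnBanach.
Context {R : realType} {V : lmodType R} (W : V -> Prop).
Hypothesis W_lin : forall (a : R) x y, W x -> W y -> W (a *: x + y).
Hypothesis W0 : W 0.

Let WD x y : W x -> W y -> W (x + y).
Proof. by move=> Wx Wy; rewrite -[x]scale1r; exact: W_lin. Qed.

Let WZ (a : R) x : W x -> W (a *: x).
Proof. by move=> Wx; rewrite -[_ *: _]addr0; exact: W_lin. Qed.

Let WN x : W x -> W (- x).
Proof. by move=> Wx; rewrite -scaleN1r; exact: WZ. Qed.

(** Relative to a subspace [W], because the main application is to the simple dual-valued functions,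
    a subspace of [T -> X -> R^o]. *)
Definition sublinear_on (q : V -> R) :=
  (forall x y, W x -> W y -> q (x + y) <= q x + q y) /\
  (forall (c : R) x, 0 <= c -> W x -> q (c *: x) <= c * q x).

Lemma sublinear_on0 q : sublinear_on q -> q 0 = 0.
Proof.
move=> [qD qZ]; apply/eqP; rewrite eq_le; apply/andP; split.
  by have := qZ 0 0 (lexx _) W0; rewrite scale0r mul0r.
by have := qD _ _ W0 W0; rewrite addr0 lerDl.
Qed.

Lemma sublinear_on_opp q x : sublinear_on q -> W x -> - q (- x) <= q x.
Proof.
move=> sq Wx; have := sq.1 _ _ Wx (WN Wx).
by rewrite subrr (sublinear_on0 sq); lra.
Qed.

Lemma inf_le_elt (A : set R) (m x : R) :
  (forall y, A y -> m <= y) -> A x -> inf A <= x.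
Proof. by move=> mA Ax; apply: ge_inf => //; exists m. Qed.

(** Supplies lower bounds of chains for Zorn's lemma. The minorant [m] keeps the infima finite;
    comparability lets the smaller of two members serve both summands in subadditivity. *)
Lemma sublinear_chain_inf (F : set (V -> R)) (m : V -> R) :
  F !=set0 -> (forall q x, F q -> W x -> sublinear_on q /\ m x <= q x) ->
  (forall q1 q2, F q1 -> F q2 ->
     (forall x, W x -> q1 x <= q2 x) \/ (forall x, W x -> q2 x <= q1 x)) ->
  sublinear_on (fun x => inf [set q x | q in F]).
Proof.
move=> [q0 Fq0] Fm Fchain.
have ne x : [set q x | q in F] !=set0 by exists (q0 x); exists q0.
have le x q : F q -> W x -> inf [set q x | q in F] <= q x.
  move=> Fq Wx; apply: (@inf_le_elt _ (m x)); last by exists q.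
  by move=> _ [q' Fq' <-]; exact: (Fm _ _ Fq' Wx).2.
split=> [x y Wx Wy | c x c0 Wx].
  rewrite -lerBlDr; apply: lb_le_inf => // _ [q1 Fq1 <-].
  rewrite lerBlDr -lerBlDl; apply: lb_le_inf => // _ [q2 Fq2 <-].
  rewrite lerBlDl.
  have [le12|le21] := Fchain _ _ Fq1 Fq2.
  - apply: (le_trans (le _ _ Fq1 (WD Wx Wy))).
    apply: (le_trans ((Fm _ _ Fq1 W0).1.1 _ _ Wx Wy)).
    by rewrite lerD2l; exact: le12.
  - apply: (le_trans (le _ _ Fq2 (WD Wx Wy))).
    apply: (le_trans ((Fm _ _ Fq2 W0).1.1 _ _ Wx Wy)).
    by rewrite lerD2r; exact: le21.
have [c_eq0|c_neq0] := eqVneq c 0.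
  rewrite c_eq0 mul0r scale0r; apply: (le_trans (le _ _ Fq0 W0)).
  by rewrite (sublinear_on0 (Fm _ _ Fq0 W0).1).
have c_gt0 : 0 < c by rewrite lt_def c_neq0.
rewrite -ler_pdivrMl//; apply: lb_le_inf => // _ [q Fq <-].
rewrite ler_pdivrMl//; apply: (le_trans (le _ _ Fq (WZ c Wx))).
exact: (Fm _ _ Fq W0).1.2.
Qed.

(* A minimal sublinear functional is linear: it cannot lie strictly above
   [x |-> inf_(s >= 0) q (x + s v) - s q v], which is again sublinear. *)
Lemma minimal_sublinear_additive q : sublinear_on q ->
  (forall q', sublinear_on q' -> (forall x, W x -> q' x <= q x) ->
     forall x, W x -> q x <= q' x) ->
  forall x v, W x -> W v -> q (x + v) = q x + q v.
Proof.
move=> sq qmin x v Wx Wv; apply/eqP; rewrite eq_le sq.1//=.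
pose S y := [set q (y + s *: v) - s * q v | s in [set s : R | 0 <= s]].
have S_lb y z : W y -> S y z -> - q (- y) <= z.
  move=> Wy [s /= s0 <-]; suff : s * q v <= q (y + s *: v) + q (- y) by lra.
  apply: (@le_trans _ _ (q (s *: v))); last first.
    rewrite -[X in q X <= _](addKr y) addrC.
    by apply: sq.1; [apply: WD => //; exact: WZ|exact: WN].
  move: s0; rewrite le_eqVlt => /predU1P[<-|s0].
    by rewrite mul0r scale0r (sublinear_on0 sq).
  (* The inequality [s * q v <= q (s *: v)] is homogeneity with factor [s^-1] applied to
     [s *: v]. *)
  rewrite -ler_pdivlMl// -[X in q X <= _]scale1r -(mulVf (lt0r_neq0 s0)) -scalerA.
  by apply: sq.2; [rewrite invr_ge0 ltW|exact: WZ].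
have S_ne y : S y !=set0 by exists (q (y + 0 *: v) - 0 * q v); exists 0 => //=.
have S_le y s : W y -> 0 <= s -> inf (S y) <= q (y + s *: v) - s * q v.
  move=> Wy s0; apply: (@inf_le_elt _ (- q (- y))); last by exists s.
  by move=> z; exact: S_lb.
have infS_sub : sublinear_on (fun y => inf (S y)).
  split=> [y z Wy Wz|c y c0 Wy].
    rewrite -lerBlDr; apply: lb_le_inf => // _ [s /= s0 <-].
    rewrite lerBlDr -lerBlDl; apply: lb_le_inf => // _ [u /= u0 <-].
    rewrite lerBlDl; apply: (le_trans (S_le _ (s + u) (WD Wy Wz) (addr_ge0 s0 u0))).
    have -> : y + z + (s + u) *: v = (y + s *: v) + (z + u *: v).
      by rewrite scalerDl addrACA.
    have := sq.1 _ _ (WD Wy (WZ s Wv)) (WD Wz (WZ u Wv)).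
    by lra.
  move: c0; rewrite le_eqVlt => /predU1P[<-|c0].
    rewrite mul0r scale0r; apply: (le_trans (S_le _ 0 W0 (lexx _))).
    by rewrite scale0r addr0 (sublinear_on0 sq) mul0r subrr.
  rewrite -ler_pdivrMl//; apply: lb_le_inf => // _ [s /= s0 <-].
  rewrite ler_pdivrMl//.
  apply: (le_trans (S_le _ (c * s) (WZ c Wy) (mulr_ge0 (ltW c0) s0))).
  rewrite -scalerA -scalerDr mulrBr mulrA lerD2r.
  by apply: sq.2; [exact: ltW|apply: WD => //; exact: WZ].
have := qmin _ infS_sub => /(_ _ x Wx) h.
have {}h : q x <= inf (S x).
  apply: h => y Wy; apply: (le_trans (S_le y 0 Wy (lexx _))).
  by rewrite scale0r addr0 mul0r subr0.
(* The parameter [s = 1] turns minimality into [q x <= q (x + v) - q v], the missing half. *)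
have := S_le _ 1 Wx ler01; rewrite scale1r mul1r => h'.
by have := le_trans h h'; lra.
Qed.

(** A minimal sublinear functional below [q], given by Zorn's lemma, is additive, hence odd; oddness
    upgrades the one-sided homogeneity to an equality for all scalars. *)
Lemma exists_linear_le_sublinear q : sublinear_on q ->
  exists L : V -> R,
    (forall (a : R) x y, W x -> W y -> L (a *: x + y) = a * L x + L y) /\
    (forall x, W x -> L x <= q x).
Proof.
move=> sq.
pose Pq q' := sublinear_on q' /\ forall x, W x -> q' x <= q x.
pose Tq := {q' : V -> R | Pq q'}.
(* The order is reversed: a maximal element for [rel] is a minimal functional. *)
pose rel (s t : Tq) := `[< forall x, W x -> sval t x <= sval s x >].
have tq0 : Tq by exists q; split.
have [||A totA|[L [sL Lq]] Lmin] := @ZL_preorder Tq tq0 rel.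
- by move=> t; apply/asboolP.
- move=> r s t /asboolP rs /asboolP st; apply/asboolP => x Wx.
  exact: le_trans (st _ Wx) (rs _ Wx).
- have [[t0 At0]|Ane] := pselect (A !=set0); last first.
    by exists tq0 => s As; exfalso; apply: Ane; exists s.
  pose F := [set sval t | t in A].
  pose m x := - q (- x).
  have Fm q' x : F q' -> W x -> sublinear_on q' /\ m x <= q' x.
    move=> [[q'' [sq'' q''q]] _ <-] Wx; split => //=.
    have := sublinear_on_opp sq'' Wx; apply: le_trans.
    by rewrite lerN2; exact/q''q/WN.
  have FF q1 q2 : F q1 -> F q2 ->
     (forall x, W x -> q1 x <= q2 x) \/ (forall x, W x -> q2 x <= q1 x).
    move=> [t1 At1 <-] [t2 At2 <-].
    by have [/asboolP|/asboolP] := totA _ _ At1 At2; [right|left].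
  have Fne : F !=set0 by exists (sval t0); exists t0.
  have sinf := sublinear_chain_inf Fne Fm FF.
  have infle q' x : F q' -> W x -> inf [set q x | q in F] <= q' x.
    move=> Fq' Wx; apply: (@inf_le_elt _ (m x)); last by exists q'.
    by move=> _ [q'' Fq'' <-]; exact: (Fm _ _ Fq'' Wx).2.
  have infq x : W x -> inf [set q x | q in F] <= q x.
    move=> Wx; have Ft0 : F (sval t0) by exists t0.
    by apply: (le_trans (infle _ _ Ft0 Wx)); exact: (svalP t0).2.
  exists (exist Pq _ (conj sinf infq)) => s As; apply/asboolP => x Wx /=.
  by apply: infle => //; exists s.
- have Ladd := @minimal_sublinear_additive L sL.
  have {}Ladd x v : W x -> W v -> L (x + v) = L x + L v.
    apply: Ladd => q' sq' q'L z Wz.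
    have q'q y : W y -> q' y <= q y by move=> Wy; exact: le_trans (q'L _ Wy) (Lq _ Wy).
    have := Lmin (exist Pq q' (conj sq' q'q)).
    by move=> /(_ (asboolT q'L)) /asboolP /(_ _ Wz).
  have LN x : W x -> L (- x) = - L x.
    move=> Wx; apply/eqP; rewrite -addr_eq0 -Ladd// ?addNr ?(sublinear_on0 sL)//.
    exact: WN.
  have LZp (c : R) x : 0 <= c -> W x -> L (c *: x) = c * L x.
    move=> c0 Wx; apply/eqP; rewrite eq_le sL.2//=.
    have := sL.2 c (- x) c0 (WN Wx).
    by rewrite scalerN !LN//; [rewrite mulrN lerN2|exact: WZ].
  exists L; split => // a x y Wx Wy; rewrite Ladd//; last exact: WZ.
  congr (_ + _); have [a0|a0] := leP 0 a; first exact: LZp.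
  rewrite -[a]opprK scaleNr LN; last exact: WZ.
  by rewrite LZp ?mulNr// oppr_ge0 ltW.
Qed.

(* The functional to be extended is given by a parametrised graph
   [w i |-> c i], which is closed under linear combinations. *)
Theorem hahn_banach q (J : Type) (w : J -> V) (c : J -> R) (i0 : J) :
  sublinear_on q -> (forall i, W (w i)) -> (forall i, c i <= q (w i)) ->
  (forall (a : R) i j, exists k, w k = a *: w i + w j /\ c k = a * c i + c j) ->
  exists L : V -> R,
    [/\ forall (a : R) x y, W x -> W y -> L (a *: x + y) = a * L x + L y,
        forall x, W x -> L x <= q x & forall i, L (w i) = c i].
Proof.
move=> sq Ww cq Jlin.
have [z [wz cz]] : exists z, w z = 0 /\ c z = 0.
  by have [k [wk ck]] := Jlin (- 1) i0 i0; exists k; rewrite wk ck scaleN1r mulN1r !addNr.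
have JZ (a : R) i : exists k, w k = a *: w i /\ c k = a * c i.
  by have [k] := Jlin a i z; rewrite wz cz !addr0; exists k.
(* A linear [L] below the infimum of [S] extends the graph: at [- w i] it gives [c i <= L (w i)],
   and the graph point for [-1] times [i] gives the converse. *)
pose S x := [set q (x + w i) - c i | i in [set: J]].
have S_lb x y : W x -> S x y -> - q (- x) <= y.
  move=> Wx [i _ <-]; have := sq.1 (x + w i) (- x) (WD Wx (Ww i)) (WN Wx).
  by rewrite addrAC subrr add0r; have := cq i; lra.
have S_ne x : S x !=set0 by exists (q (x + w i0) - c i0); exists i0.
have S_le x i : W x -> inf (S x) <= q (x + w i) - c i.
  move=> Wx; apply: (@inf_le_elt _ (- q (- x))); last by exists i.
  by move=> y; exact: S_lb.
have sS : sublinear_on (fun x => inf (S x)).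
  split=> [x y Wx Wy|a x a0 Wx].
    rewrite -lerBlDr; apply: lb_le_inf => // _ [i _ <-].
    rewrite lerBlDr -lerBlDl; apply: lb_le_inf => // _ [j _ <-].
    rewrite lerBlDl; have [k [wk ck]] := Jlin 1 i j.
    apply: (le_trans (S_le _ k (WD Wx Wy))); rewrite wk ck scale1r mul1r addrACA.
    by have := sq.1 _ _ (WD Wx (Ww i)) (WD Wy (Ww j)); lra.
  move: a0; rewrite le_eqVlt => /predU1P[<-|a0].
    rewrite mul0r scale0r; apply: (le_trans (S_le _ z W0)).
    by rewrite wz cz addr0 subr0 (sublinear_on0 sq).
  rewrite -ler_pdivrMl//; apply: lb_le_inf => // _ [i _ <-]; rewrite ler_pdivrMl//.
  have [k [wk ck]] := JZ a i; apply: (le_trans (S_le _ k (WZ a Wx))).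
  rewrite wk ck -scalerDr mulrBr lerD2r.
  by apply: sq.2; [exact: ltW|exact: WD].
have [L [Llin LS]] := exists_linear_le_sublinear sS.
have L0 : L 0 = 0.
  by have := Llin (- 1) 0 0 W0 W0; rewrite scaler0 addr0 mulN1r addNr.
have LN x : W x -> L (- x) = - L x.
  by move=> Wx; have := Llin (- 1) x 0 Wx W0; rewrite L0 !addr0 scaleN1r mulN1r.
have Lw i : c i <= L (w i).
  rewrite -lerN2 -LN//; apply: (le_trans (LS _ (WN (Ww i)))).
  by apply: (le_trans (S_le _ i (WN (Ww i)))); rewrite addNr (sublinear_on0 sq) sub0r.
exists L; split => // [x Wx|i].
  by apply: (le_trans (LS _ Wx)); rewrite (le_trans (S_le _ z Wx))// wz cz addr0 subr0.
apply/eqP; rewrite eq_le Lw andbT.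
have [k [wk ck]] := JZ (- 1) i; have := Lw k.
by rewrite wk ck scaleN1r mulN1r LN// lerN2.
Qed.

End HahnBanach.

(** * Seminorms, the metric, and continuous functions on compact sets *)

Section FrechetBasics.
Context {R : realType} {X : lmodType R} (p : nat -> X -> R).
Hypothesis p_seminorm : forall n, seminorm (p n).

Lemma seminorm0 n : p n 0 = 0.
Proof. by have := (p_seminorm n).2 0 0; rewrite scale0r normr0 mul0r. Qed.

Lemma seminormN n x : p n (- x) = p n x.
Proof. by rewrite -scaleN1r (p_seminorm n).2 normrN1 mul1r. Qed.

Lemma seminorm_ge0 n x : 0 <= p n x.
Proof.
have := (p_seminorm n).1 x (- x); rewrite subrr seminorm0 seminormN; lra.
Qed.

Lemma seminorm_triangle n x y z : p n (x - z) <= p n (x - y) + p n (y - z).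
Proof. by have := (p_seminorm n).1 (x - y) (y - z); rewrite addrA subrK. Qed.

Lemma fdist_sum_le2 N x y :
  \sum_(n < N) ((2%:R ^- n) * Num.min 1 (p n (x - y))) <= 2 :> R.
Proof.
(* The tail [2 * 2 ^- N] of the geometric series is carried along so that the induction closes. *)
suff : \sum_(n < N) ((2%:R ^- n) * Num.min 1 (p n (x - y))) + 2 * 2 ^- N <= 2 :> R.
  by apply: le_trans; rewrite lerDl mulr_ge0// invr_ge0 exprn_ge0.
elim: N => [|N IH]; first by rewrite big_ord0 add0r expr0 invr1 mulr1.
rewrite big_ord_recr/=; apply: le_trans IH.
rewrite -addrA lerD2l exprS invfM.
have : 0 <= (2 ^- N : R) by rewrite invr_ge0 exprn_ge0.
have : Num.min 1 (p N (x - y)) <= 1 :> R by rewrite ge_min lexx.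
by rewrite mulrA divff ?pnatr_eq0// mul1r; nra.
Qed.

Lemma fdist_le2 x y : fdist p x y <= 2.
Proof.
apply: ge_sup; first by exists (\sum_(n < 0) ((2%:R ^- n) * Num.min 1 (p n (x - y)))); exists 0%N.
by move=> _ [N _ <-]; exact: fdist_sum_le2.
Qed.

Lemma fdist_ge_term n x y : 2 ^- n * Num.min 1 (p n (x - y)) <= fdist p x y.
Proof.
apply: (@le_trans _ _ (\sum_(i < n.+1) ((2%:R ^- i) * Num.min 1 (p i (x - y))))).
  rewrite big_ord_recr/= lerDr; apply: sumr_ge0 => i _.
  by rewrite mulr_ge0 ?invr_ge0 ?exprn_ge0// le_min ler01 seminorm_ge0.
apply: ub_le_sup; last by exists n.+1.
by exists 2 => _ [N _ <-]; exact: fdist_sum_le2.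
Qed.

Lemma fdist_ge0 x y : 0 <= fdist p x y.
Proof.
apply: le_trans (fdist_ge_term 0 x y).
by rewrite mulr_ge0 ?invr_ge0 ?exprn_ge0// le_min ler01 seminorm_ge0.
Qed.

(** The factor [Num.min 1 e] in the radius ensures that the truncation at 1 inside the metric is
    inactive. *)
Lemma fdist_small n (e : R) : 0 < e ->
  exists2 d : R, 0 < d & forall x y, fdist p x y < d -> p n (x - y) < e.
Proof.
move=> e0; have n0 : (0 : R) < 2 ^- n by rewrite invr_gt0 exprn_gt0.
exists (2 ^- n * Num.min 1 e) => [|x y dxy].
  by rewrite mulr_gt0// lt_min ltr01.
have := le_lt_trans (fdist_ge_term n x y) dxy; rewrite ltr_pM2l//.
by rewrite lt_min !gt_min !ltxx/= => /andP[p1 /orP[e1|//]]; lra.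
Qed.

(** The continuity clause of [fdual], isolated so that it also covers nonlinear functions such as
    sums of squared residuals. *)
Definition fcont (F : X -> R) := forall x (e : R), 0 < e ->
  exists2 d : R, 0 < d & forall y, fdist p x y < d -> `|F x - F y| < e.

Lemma fcontN F : fcont F -> fcont (fun x => - F x).
Proof.
move=> cF x e e0; have [d d0 dF] := cF x e e0; exists d => // y /dF.
by rewrite -opprD normrN.
Qed.

Lemma fcontD F H : fcont F -> fcont H -> fcont (fun x => F x + H x).
Proof.
move=> cF cH x e e0; have e2 : 0 < e / 2 by rewrite divr_gt0.
have [d d0 dF] := cF x _ e2; have [d' d'0 dH] := cH x _ e2.
exists (Num.min d d') => [|y]; first by rewrite lt_min d0.
rewrite lt_min => /andP[/dF hF /dH hH].
rewrite opprD addrACA (le_lt_trans (ler_normD _ _))//; lra.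
Qed.

Lemma fcont_sum m (F : 'I_m -> X -> R) :
  (forall i, fcont (F i)) -> fcont (fun x => \sum_i F i x).
Proof.
elim: m F => [F _ x e e0|m IH F cF].
  by exists 1 => // y _; rewrite !big_ord0 subrr normr0.
have -> : (fun x => \sum_i F i x) =
    (fun x => \sum_(i < m) F (widen_ord (leqnSn m) i) x + F ord_max x).
  by apply/funext => x; rewrite big_ord_recr.
by apply: fcontD => //; exact: IH.
Qed.

Lemma fcont_sqr F : fcont F -> fcont (fun x => F x ^+ 2).
Proof.
move=> cF x e e0; pose M := `|F x| + 1.
have M0 : 0 < M by rewrite ltr_wpDl.
pose e' := Num.min 1 (e / (2 * M)).
have e'0 : 0 < e' by rewrite lt_min ltr01 divr_gt0// mulr_gt0.
have [d d0 dF] := cF x e' e'0; exists d => // y /dF.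
rewrite lt_min => /andP[h1 h2].
rewrite subr_sqr normrM.
have hFy : `|F x + F y| <= 2 * M.
  have -> : F x + F y = 2 * F x - (F x - F y) by ring.
  rewrite (le_trans (ler_normB _ _))// normrM (ger0_norm (ler0n _ 2)) /M; lra.
apply: (@le_lt_trans _ _ (`|F x - F y| * (2 * M))).
  by rewrite ler_wpM2l.
by rewrite -ltr_pdivlMr// mulr_gt0.
Qed.

Lemma fopen_gt F (c : R) : fcont F -> fopen p [set x | c < F x].
Proof.
move=> cF x /= cx; have [|d d0 dF] := cF x (F x - c); first by rewrite subr_gt0.
exists d => // y /dF; rewrite ltr_distlC => /andP[+ _] /=; lra.
Qed.

Lemma fopen_neq F (c : R) : fcont F -> fopen p [set x | F x != c].
Proof.
move=> cF x /= cx.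
have [|d d0 dF] := cF x `|F x - c|; first by rewrite normr_gt0 subr_eq0.
exists d => // y /dF h /=; apply: contraTneq h => ->.
by rewrite ltxx.
Qed.

(** Were no minimum attained, the open sets where [F] exceeds [F z], for [z] in [K], would cover
    [K]; the [z] of smallest value in a finite subcover would remain uncovered. *)
Lemma fcompact_argmin K F : K !=set0 -> fcompact p K -> fcont F ->
  exists2 x0, K x0 & forall x, K x -> F x0 <= F x.
Proof.
move=> K0 cK cF; apply: contrapT => noarg.
pose I := {x | K x}; pose U (i : I) := [set x | F (sval i) < F x].
have [i|x Kx|m [s Ks]] := cK I U.
- exact: fopen_gt.
- apply: contrapT => nU; apply: noarg; exists x => // y Ky; rewrite leNgt.
  by apply/negP => yx; apply: nU; exists (exist _ y Ky).
- case: m s Ks => [|m] s Ks.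
    by have [x /Ks[[]]] := K0.
  pose k := [arg min_(j < ord0 | true) F (sval (s j))]%O.
  have [j _] := Ks _ (svalP (s k)).
  rewrite /U /= /k; case: arg_minP => //= i _ /(_ j isT).
  by rewrite leNgt => /negP.
Qed.

Lemma fcompact_bounded K F : K !=set0 -> fcompact p K -> fcont F ->
  exists M, forall x, K x -> `|F x| <= M.
Proof.
move=> K0 cK cF.
have [x1 Kx1 h1] := fcompact_argmin K0 cK cF.
have [x2 Kx2 h2] := fcompact_argmin K0 cK (fcontN cF).
exists (`|F x1| + `|F x2|) => x Kx.
have := h1 _ Kx; have := h2 _ Kx; rewrite lerN2 => l2 l1.
have := ler_norm (F x2); have := ler_norm (- F x1).
rewrite normrN ler_norml; have := normr_ge0 (F x1); have := normr_ge0 (F x2).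
by move=> *; apply/andP; split; lra.
Qed.

(** Compactness bounds the values, so the [sup] in [sigma] is a true supremum and not a default. *)
Lemma sigma_ge K F x : fcompact p K -> fcont F -> K x -> F x <= sigma F K.
Proof.
move=> cK cF Kx; apply: ub_le_sup; last by exists x.
have K0 : K !=set0 by exists x.
have [M hM] := fcompact_bounded K0 cK cF; exists M => _ [y Ky <-].
by rewrite (le_trans (ler_norm _)) ?hM.
Qed.

Lemma sigma_le K (F : X -> R) (c : R) : K !=set0 -> (forall x, K x -> F x <= c) ->
  sigma F K <= c.
Proof.
move=> [x Kx] h; apply: ge_sup; first by exists (F x); exists x.
by move=> _ [y Ky <-]; exact: h.
Qed.

Lemma sigmaD K F H : K !=set0 -> fcompact p K -> fcont F -> fcont H ->
  sigma (fun x => F x + H x) K <= sigma F K + sigma H K.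
Proof.
by move=> K0 cK cF cH; apply: sigma_le => // x Kx; rewrite lerD// sigma_ge.
Qed.

Lemma sigmaZ K F (c : R) : 0 <= c -> K !=set0 -> fcompact p K -> fcont F ->
  sigma (fun x => c * F x) K <= c * sigma F K.
Proof.
by move=> c0 K0 cK cF; apply: sigma_le => // x Kx; rewrite ler_wpM2l// sigma_ge.
Qed.

(** * The dual space, norming functionals and the least-squares argument *)

Lemma fdual_fcont f : fdual p f -> fcont f.
Proof. by case. Qed.

Lemma fdual0 : fdual p (fun _ => 0).
Proof.
split=> [*|x e e0]; first by rewrite mulr0 addr0.
by exists 1 => // y _; rewrite subrr normr0.
Qed.

Lemma fdual_at0 f : fdual p f -> f 0 = 0.
Proof. by case=> + _ => /(_ (- 1) 0 0); rewrite scaler0 addr0 mulN1r addNr. Qed.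

Lemma fdualZ f (a : R) x : fdual p f -> f (a *: x) = a * f x.
Proof. by move=> df; rewrite -[_ *: _]addr0 df.1 (fdual_at0 df) addr0. Qed.

Lemma fdual_affine (a : R) f g : fdual p f -> fdual p g ->
  fdual p (fun x => a * f x + g x).
Proof.
move=> [fl fc] [gl gc]; split=> [b x y|]; first by rewrite fl gl; ring.
apply: fcontD => // x e e0.
have [|d d0 hd] := fc x (e / (`|a| + 1)); first by rewrite divr_gt0// ltr_wpDl.
exists d => // y /hd; rewrite ltr_pdivlMr ?ltr_wpDl//; apply: le_lt_trans.
by rewrite -mulrBr normrM mulrC ler_wpM2l// lerDl.
Qed.

Lemma fdualD f g : fdual p f -> fdual p g -> fdual p (fun x => f x + g x).
Proof.
move=> df dg; have := fdual_affine 1 df dg.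
by under eq_fun do rewrite mul1r.
Qed.

Lemma fdual_scale (a : R) f : fdual p f -> fdual p (fun x => a * f x).
Proof.
move=> df; have := fdual_affine a df fdual0.
by under eq_fun do rewrite addr0.
Qed.

Lemma fdual_comb m (a : 'I_m -> R) (f : 'I_m -> X -> R) :
  (forall i, fdual p (f i)) -> fdual p (fun x => \sum_i a i * f i x).
Proof.
elim: m a f => [a f _|m IH a f df].
  by under eq_fun do rewrite big_ord0; exact: fdual0.
under eq_fun do rewrite big_ord_recl.
by apply: fdual_affine => //; exact: (IH (fun i => a (lift ord0 i)) (fun i => f (lift ord0 i))).
Qed.

Lemma fdual_le_seminorm n (f : X -> R) :
  (forall (a : R) x y, f (a *: x + y) = a * f x + f y) ->
  (forall x, `|f x| <= p n x) -> fdual p f.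
Proof.
move=> fl fp; split => // x e e0; have [d d0 hd] := fdist_small n e0.
exists d => // y /hd; apply: le_lt_trans.
by rewrite addrC -mulN1r -fl scaleN1r addrC; exact: fp.
Qed.

(** Extends [s *: d |-> s * p n d] from the line through [d], where [p n] dominates it;
    parametrising by [s] also covers [d = 0]. *)
Lemma exists_norming_functional n d : exists f,
  [/\ fdual p f, forall x, `|f x| <= p n x & f d = p n d].
Proof.
have sp : @sublinear_on R X (fun _ => True) (p n).
  split=> [x y _ _|c x c0 _]; first exact: (p_seminorm n).1.
  by rewrite (p_seminorm n).2 ger0_norm.
have [//|//|//|||f [fl fp fd]] := @hahn_banach R X (fun _ => True) _ _ (p n) R
   (fun s => s *: d) (fun s => s * p n d) 0 sp.
- by move=> s; rewrite (p_seminorm n).2 ler_wpM2r ?seminorm_ge0// ler_norm.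
- by move=> a s t; exists (a * s + t); rewrite scalerDl scalerA mulrDl mulrA.
have {}fl (a : R) x y : f (a *: x + y) = a * f x + f y by exact: fl.
have f0 : f 0 = 0 by have := fl (- 1) 0 0; rewrite scaler0 addr0 mulN1r addNr.
have fn x : `|f x| <= p n x.
  rewrite ler_norml fp// andbT lerNl -mulN1r.
  have -> : - 1 * f x = f (- x) by have := fl (- 1) x 0; rewrite f0 !addr0 scaleN1r.
  by rewrite -(seminormN n x) fp.
exists f; split => //; first exact: fdual_le_seminorm fn.
by have := fd 1; rewrite scale1r mul1r.
Qed.

(* If no point of K does, the least-squares residual at a closest point of K
   provides the coefficients of a combination violating the hypothesis. *)
Lemma exists_moment_point K (J : Type) (y : J -> X -> R) (z : J -> R) :
  ck p K -> (forall j, fdual p (y j)) ->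
  (forall m (s : 'I_m -> J) (a : 'I_m -> R),
    \sum_k a k * z (s k) <= sigma (fun x => \sum_k a k * y (s k) x) K) ->
  exists2 x, K x & forall j, y j x = z j.
Proof.
move=> [K0 cK vK] dy hz; apply: contrapT => nox.
(* Otherwise the open sets [y j x != z j] cover [K], and compactness leaves finitely many conditions
   that no point of [K] meets simultaneously. *)
have [j|x Kx|m [s Ks]] := cK J (fun j => [set x | y j x != z j]).
- exact/fopen_neq/fdual_fcont.
- apply: contrapT => nU; apply: nox; exists x => // j; apply/eqP.
  by apply: contrapT => /negP yz; apply: nU; exists j.
have cy k : fcont (fun x => z (s k) - y (s k) x).
  apply: fcontD; last exact/fcontN/fdual_fcont.
  by move=> x e e0; exists 1 => // u _; rewrite subrr normr0.
have [x0 Kx0 x0min] := fcompact_argmin K0 cK (fcont_sum (fun k => fcont_sqr (cy k))).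
pose a k := z (s k) - y (s k) x0.
pose S := \sum_k a k ^+ 2.
have S0 : 0 < S.
  have [k _ /= yk] := Ks _ Kx0; rewrite /S (bigD1 k)//= ltr_pwDl//.
    by rewrite lt_def sqr_ge0 andbT expf_neq0// /a subr_eq0 eq_sym.
  by apply: sumr_ge0 => i _; exact: sqr_ge0.
(* First-order optimality of [x0]: moving from [x0] towards [x] inside the convex set [K] cannot
   decrease the sum of squares. *)
have key x : K x -> \sum_k a k * (y (s k) x - y (s k) x0) <= 0.
  move=> Kx; set A := \sum_k _; pose B := \sum_k (y (s k) x - y (s k) x0) ^+ 2.
  have B0 : 0 <= B by apply: sumr_ge0 => k _; exact: sqr_ge0.
  have h (l : R) : 0 <= l <= 1 -> 2 * l * A <= l ^+ 2 * B.
    move=> l01; have := x0min _ (vK x x0 l Kx Kx0 l01).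
    rewrite -subr_ge0 -sumrB.
    have -> : \sum_(i < m) ((z (s i) - y (s i) (l *: x + (1 - l) *: x0)) ^+ 2
        - (z (s i) - y (s i) x0) ^+ 2) = l ^+ 2 * B - 2 * l * A.
      rewrite /A /B !mulr_sumr -sumrB; apply: eq_bigr => i _.
      by rewrite (dy (s i)).1 (fdualZ _ _ (dy (s i))) /a; ring.
    by rewrite subr_ge0.
  rewrite leNgt; apply/negP => A0.
  have AB : 0 < A + B by rewrite ltr_pwDl.
  (* This step length [l] lies in the unit interval and satisfies [l * B = A - l * A < A], against
     [2 * A <= l * B]. *)
  have := h (A / (A + B)); rewrite ler_pdivrMr// mul1r lerDl B0 divr_ge0 ?(ltW AB) ?(ltW A0)//.
  move=> /(_ isT); set l := A / (A + B).
  have l0 : 0 < l by rewrite divr_gt0.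
  have lAB : l * (A + B) = A by rewrite /l divfK// gt_eqF.
  rewrite expr2 => h2; have h3 : 2 * A <= l * B by rewrite -(ler_pM2l l0); lra.
  by have := mulr_gt0 l0 A0; lra.
(* With the residuals at [x0] as coefficients, the assumed inequality fails by at least [S]. *)
have := hz m s a; apply/negP; rewrite -ltNge.
apply: (@le_lt_trans _ _ (\sum_k a k * y (s k) x0)).
  apply: sigma_le => // x /key; under eq_bigr do rewrite mulrBr.
  by rewrite sumrB subr_le0.
rewrite -subr_gt0 -sumrB; rewrite (_ : \sum_(i < m) _ = S)//.
by apply: eq_bigr => k _; rewrite -mulrBr expr2.
Qed.

Lemma rational_approx (a c e : R) : 0 < e -> exists q : rat, `|a - ratr q| * c < e.
Proof.
move=> e0; have c0 : 0 < `|c| + 1 by rewrite ltr_wpDl.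
have [|q] := @rat_in_itvoo R (a - e / (`|c| + 1)) (a + e / (`|c| + 1)).
  by have := divr_gt0 e0 c0; lra.
rewrite in_itv/= -ltr_distl distrC ltr_pdivlMr// => h; exists q; apply: le_lt_trans h.
by rewrite ler_wpM2l// (le_trans (ler_norm _))// lerDl.
Qed.

(** Both sides depend continuously on the coefficients because the functionals are bounded on [K].
    This reduces the moment condition to countably many inequalities. *)
Lemma rational_comb_le_sigma K m (y : 'I_m -> X -> R) (z : 'I_m -> R) :
  K !=set0 -> fcompact p K -> (forall j, fdual p (y j)) ->
  (forall a : 'I_m -> rat,
    \sum_k ratr (a k) * z k <= sigma (fun x => \sum_k ratr (a k) * y k x) K) ->
  forall a : 'I_m -> R, \sum_k a k * z k <= sigma (fun x => \sum_k a k * y k x) K.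
Proof.
move=> K0 cK dy h a; apply/ler_addgt0Pr => e e0.
have /choice[M hM] k : exists M, forall x, K x -> `|y k x| <= M.
  exact: fcompact_bounded (fdual_fcont (dy k)).
(* The [m] errors add up to at most [e / 2] on each side; [m.+1] avoids a zero denominator when
   [m = 0]. *)
have e'0 : 0 < e / m.+1%:R / 2 by rewrite !divr_gt0.
have /choice[b hb] k := rational_approx (a k) (`|z k| + `|M k|) e'0.
have sm : \sum_(k < m) (e / m.+1%:R / 2) <= e / 2.
  rewrite sumr_const card_ord -[X in X <= _]mulr_natr mulrAC ler_pM2r ?invr_gt0//.
  by rewrite mulrAC ler_pdivrMr// ler_pM2l// ler_nat.
have h1 : \sum_k a k * z k <= \sum_k ratr (b k) * z k + e / 2.
  rewrite -lerBlDl -sumrB; apply: le_trans sm; apply: ler_sum => k _.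
  rewrite -mulrBl (le_trans (ler_norm _))// normrM.
  by apply: (le_trans _ (ltW (hb k))); rewrite ler_wpM2l// lerDl.
have h2 : sigma (fun x => \sum_k ratr (b k) * y k x) K <=
    sigma (fun x => \sum_k a k * y k x) K + e / 2.
  apply: sigma_le => // x Kx.
  have := sigma_ge cK (fdual_fcont (fdual_comb a dy)) Kx; move=> hx.
  suff : \sum_k ratr (b k) * y k x <= \sum_k a k * y k x + e / 2 by lra.
  rewrite -lerBlDl -sumrB; apply: le_trans sm; apply: ler_sum => k _.
  rewrite -mulrBl (le_trans (ler_norm _))// normrM distrC.
  apply: (le_trans _ (ltW (hb k))); rewrite ler_wpM2l//.
  by rewrite (le_trans (hM _ _ Kx))// (le_trans (ler_norm _))// lerDr.
by have := h b; lra.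
Qed.

End FrechetBasics.

(** * Countably many functionals separating the points of almost every value *)

Section CountableSeparation.
Context {R : realType} {X : lmodType R} (p : nat -> X -> R).
Hypothesis p_seminorm : forall n, seminorm (p n).
Hypothesis p_nondecreasing : forall n x, p n x <= p n.+1 x.
Hypothesis p_separating : forall x, (forall n, p n x = 0) -> x = 0.

Lemma seminorm_le_nat m n x : (m <= n)%N -> p m x <= p n x.
Proof.
by move/subnK <-; elim: (n - m)%N => // k IH; rewrite addSn (le_trans IH).
Qed.

Lemma fopen_ball n c (e : R) : fopen p [set x | p n (x - c) < e].
Proof.
move=> x /= xc; have [|d d0 hd] := fdist_small p_seminorm n (e := e - p n (x - c)).
  by rewrite subr_gt0.
exists d => // y /hd; have := seminorm_triangle p_seminorm n y x c.
by rewrite -(seminormN p_seminorm n (y - x)) opprB /=; lra.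
Qed.

Lemma fcompact_net K n (e : R) : fcompact p K -> 0 < e ->
  exists s : nat -> X, forall x, K x -> exists k, p n (x - s k) < e.
Proof.
move=> cK e0.
have [i|x Kx|m [s Ks]] := cK X (fun c => [set x | p n (x - c) < e]).
- exact: fopen_ball.
- by exists x => //=; rewrite subrr seminorm0.
exists (fun k => if insub k is Some i then s i else 0) => x /Ks[k _ /=] h.
by exists k; rewrite valK.
Qed.

Lemma hausdorffC A B : hausdorff p A B = hausdorff p B A.
Proof. by rewrite /hausdorff maxC. Qed.

(** Since the metric is bounded by 2, the supremum in [hausdorff] bounds each distance to [B], and
    an infimum below [e] is undercut by some point of [B]. *)
Lemma hausdorff_near A B (e : R) a : B !=set0 -> hausdorff p A B < e -> A a ->
  exists2 b, B b & fdist p a b < e.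
Proof.
move=> [b0 Bb0] + Aa; rewrite /hausdorff gt_max => /andP[+ _].
have d2 x : pt_dist p x B <= 2.
  apply: (le_trans _ (fdist_le2 p x b0)); apply: ge_inf; last by exists b0.
  by exists 0 => _ [b _ <-]; exact: fdist_ge0.
move=> h; have : pt_dist p a B < e.
  apply: le_lt_trans h; apply: ub_le_sup; last by exists a.
  by exists 2 => _ [x _ <-].
have ne : [set fdist p a b | b in B] !=set0 by exists (fdist p a b0); exists b0.
by move=> /(inf_lt ne)[_ [b Bb <-]]; exists b.
Qed.

Lemma simple_mf_in n (A : 'I_n -> set (lebT R)) (C : 'I_n -> set X) i t :
  (forall i j, i != j -> A i `&` A j = set0) -> A i t -> simple_mf A C t = C i.
Proof.
move=> Adisj Ait; apply/seteqP; split=> [x [[j [Ajt Cjx]]|[/(_ i)//]]|x Cx].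
  have [<-//|ji] := eqVneq j i; have : (A j `&` A i) t by [].
  by rewrite Adisj.
by left; exists i.
Qed.

Lemma simple_mf_out n (A : 'I_n -> set (lebT R)) (C : 'I_n -> set X) t :
  (forall i, ~ A i t) -> simple_mf A C t = [set 0].
Proof.
move=> nA; apply/seteqP; split=> [x [[i [/nA//]]|[_ ->//]]|x ->].
by right.
Qed.

(* A single value of G in each cell of the approximating simple multifunctions
   already provides finite nets for all nearby values. *)
Lemma bochner_measurable_separable (G : R -> set X) :
  (forall t, `[0%R, 1%R]%classic t -> ck p (G t)) -> bochner_measurable p G ->
  exists D : option (nat * nat * nat * nat) -> X,
    {ae leb, forall t : lebT R, `[0%R, 1%R]%classic t ->
      forall x, G t x -> forall n (e : R), 0 < e -> exists j, p n (x - D j) < e}.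
Proof.
move=> ckG [N [A [C [_ Adisj cbC Gcvg]]]].
(* The factor 3 anticipates a path of three legs: from [x] to the cell's value, to a fixed value
   [G t0], to a net point. *)
have [eps e_gt0 eps_small] : exists2 eps : nat -> R, forall m, 0 < eps m &
    forall n e, 0 < e -> exists m, (n <= m)%N /\ 3 * eps m < e.
  exists (fun m => m.+1%:R^-1) => [m|n e e0]; first by rewrite invr_gt0.
  have [m _ hm] := near_infty_natSinv_lt (PosNum (divr_gt0 e0 (ltr0n R 3))).
  exists (maxn n m); split; first exact: leq_maxl.
  by have := hm (maxn n m) (leq_maxr _ _); rewrite /= ltr_pdivlMr// mulrC.
have /choice[d hd] m : exists d : R, 0 < d /\
    forall x y, fdist p x y < d -> p m (x - y) < eps m.
  by have [d] := fdist_small p_seminorm m (e_gt0 m); exists d.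
pose near k m t := hausdorff p (simple_mf (A k) (C k) t) (G t) < d m.
(* One net serves a whole cell: a net of [G t0] for some [t0] of the cell where the approximation is
   good; without such a [t0] there is nothing to serve. *)
have /choice[net hnet] (kim : nat * nat * nat) : exists s : nat -> X,
    forall (i : 'I_(N kim.1.1)) t, `[0%R, 1%R]%classic t ->
      i = kim.1.2 :> nat -> A kim.1.1 i t -> near kim.1.1 kim.2 t ->
      forall x, G t x -> exists l, p kim.2 (x - s l) < 3 * eps kim.2.
  case: kim => [[k i0] m] /=.
  have [[i [t0 [It0 ii0 Ait0 nt0]]]|none] := pselect (exists (i : 'I_(N k)) t,
      [/\ `[0%R, 1%R]%classic t, i = i0 :> nat, A k i t & near k m t]); last first.
    by exists (fun=> 0) => i t It ii0 Ait nt; exfalso; apply: none; exists i, t.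
  have [G0 cG _] := ckG _ It0.
  have [s hs] := fcompact_net m cG (e_gt0 m); exists s => j t It ji0 Ajt nt x Gx.
  have ij : i = j by apply/val_inj; rewrite /= ii0 ji0.
  move: Ajt nt nt0; rewrite -ij /near => Ait.
  rewrite !(simple_mf_in _ (Adisj k) (i := i))// => nt nt0.
  have [C0 _ _ _] := cbC k i.
  rewrite hausdorffC in nt.
  have [c Cc xc] := hausdorff_near C0 nt Gx.
  have [u Gu cu] := hausdorff_near G0 nt0 Cc.
  have [l ul] := hs _ Gu; exists l.
  have := seminorm_triangle p_seminorm m x c (s l).
  have := seminorm_triangle p_seminorm m c u (s l).
  by have := (hd m).2 _ _ xc; have := (hd m).2 _ _ cu; lra.
(* [None] codes the point 0, the only value of the simple multifunctions off their cells. *)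
exists (fun j => if j is Some (kim, l) then net kim l else 0).
move: Gcvg; apply: filterS => t Gcvg It x Gx n e e0.
have [m [nm me]] := eps_small n _ e0.
have [k hk] : exists k, near k m t.
  have /cvgrPdist_lt/(_ (d m) (hd m).1)[k _ hk] := Gcvg It.
  exists k; have /= := hk k (leqnn _).
  by rewrite sub0r normrN; exact/le_lt_trans/ler_norm.
suff [j hj] : exists j : option (nat * nat * nat * nat),
    p m (x - (if j is Some (kim, l) then net kim l else 0)) < 3 * eps m.
  exists j; apply: le_lt_trans (lt_trans hj me); exact: seminorm_le_nat.
have [[i Ait]|nA] := pselect (exists i, A k i t).
  have [l hl] := hnet (k, val i, m) i t It erefl Ait hk x Gx.
  by exists (Some (k, val i, m, l)).
exists None; move: hk; rewrite /near simple_mf_out; last first.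
  by move=> i Ait; apply: nA; exists i.
rewrite hausdorffC => hk.
have [|c -> xc] := hausdorff_near _ hk Gx; first by exists 0.
by have := (hd m).2 _ _ xc; have := e_gt0 m; lra.
Qed.

(** Takes a norming functional for every seminorm and every difference of two points of [D]. If all
    of them agree at [x] and [y], the one for nearby points of [D] is small on a difference that it
    norms. *)
Lemma countable_separating_family (G : R -> set X) :
  (forall t, `[0%R, 1%R]%classic t -> ck p (G t)) -> bochner_measurable p G ->
  exists (J : countType) (f : J -> X -> R), (forall j, fdual p (f j)) /\
    {ae leb, forall t : lebT R, `[0%R, 1%R]%classic t ->
      forall x y, G t x -> G t y -> (forall j, f j x = f j y) -> x = y}.
Proof.
move=> ckG bG; have [D hD] := bochner_measurable_separable ckG bG.
have /choice[f hf] (j : option (nat * nat * nat * nat) * option (nat * nat * nat * nat) * nat) :=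
  exists_norming_functional p_seminorm j.2 (D j.1.1 - D j.1.2).
eexists; exists f; split; first by move=> j; have [] := hf j.
move: hD; apply: filterS => t hD It x y Gx Gy fxy.
apply/eqP; rewrite -subr_eq0; apply/eqP/p_separating => n.
apply/eqP/negPn/negP => pxy.
have {}pxy : 0 < p n (x - y) by rewrite lt_def pxy seminorm_ge0.
(* With this radius, [p n (D i - D k)] is below two radii, hence [p n (x - y)] below four, while it
   equals five. *)
have e0 : 0 < p n (x - y) / 5 by rewrite divr_gt0.
have [i hi] := hD It x Gx n _ e0; have [k hk] := hD It y Gy n _ e0.
have [df fp fn] := hf (i, k, n); rewrite /= in fp fn.
have fB u v : f (i, k, n) (u - v) = f (i, k, n) u - f (i, k, n) v.
  by rewrite -scaleN1r addrC df.1 mulN1r addrC.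
have := fp (x - D i); have := fp (y - D k); rewrite !fB !ler_norml fxy.
rewrite fB in fn.
have := seminorm_triangle p_seminorm n x (D i) y.
have := seminorm_triangle p_seminorm n (D i) (D k) y.
rewrite -(seminormN p_seminorm n (D k - y)) opprB.
by move=> ? ? /andP[? ?] /andP[? ?]; lra.
Qed.

End CountableSeparation.

(** * Almost everywhere inequalities and densities of additive set functions *)

Section MeasureLemmas.
Context d (T : measurableType d) {R : realType}.
Variable mu : {sigma_finite_measure set T -> \bar R}.

Lemma ae_forall_countable (J : countType) (P : J -> T -> Prop) :
  (forall j, {ae mu, forall t, P j t}) -> {ae mu, forall t, forall j, P j t}.
Proof.
move=> aP.
have : {ae mu, forall t, forall n, if @unpickle J n is Some j then P j t else True}.
  apply: ae_foralln => n; case: unpickle => [j|]; first exact: aP.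
  exact: aeW.
by apply: filterS => t h j; have := h (pickle j); rewrite pickleK.
Qed.

(** Over each measurable part of the set where [v < u], the integral of [u - v] is both nonnegative
    and nonpositive, so [u - v] vanishes almost everywhere there. *)
Lemma ae_le_of_Rintegral_le I (u v : T -> R) : measurable I ->
  mu.-integrable I (EFin \o u) -> mu.-integrable I (EFin \o v) ->
  (forall A, measurable A -> A `<=` I ->
    \int[mu]_(t in A) u t <= \int[mu]_(t in A) v t) ->
  {ae mu, forall t, I t -> u t <= v t}.
Proof.
move=> mI iu iv h; pose D := I `&` [set t | (v t)%:E < (u t)%:E]%E.
have mD : measurable D.
  by apply: measurable_lte => //; exact: (measurable_int mu).
have DI : D `<=` I by exact: subIsetl.
have iuv : mu.-integrable D (EFin \o (fun t => u t - v t)).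
  have /= := integrableB mI iu iv; apply: integrableS => //.
have aeD : ae_eq mu D (EFin \o (fun t => u t - v t)) (cst 0%:E).
  apply: integral_ae_eq => //.
  move=> A AD mA; have AI := subset_trans AD DI.
  rewrite [RHS]integral0_eq//.
  have iuA : mu.-integrable A (EFin \o u) by exact: integrableS iu.
  have ivA : mu.-integrable A (EFin \o v) by exact: integrableS iv.
  apply/eqP; rewrite eq_le; apply/andP; split; last first.
    apply: integral_ge0 => t /AD[_ /=].
    by rewrite lte_fin lee_fin subr_ge0 => /ltW.
  rewrite -[leLHS]fineK; last by apply: integrable_fin_num => //; exact: integrableS iuv.
  rewrite lee_fin -/(Rintegral mu A _) RintegralB// subr_le0; exact: h.
have : {ae mu, forall t, D t -> (u t - v t)%:E = 0%:E} by exact: aeD.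
apply: filterS => t ht It; rewrite leNgt; apply/negP => vu.
have Dt : D t by split => //=; rewrite lte_fin.
by have /eqP := ht Dt; rewrite eqe subr_eq0 gt_eqF.
Qed.

(** Reduces sigma-additivity to remainders tending to 0; applied both to [nu] and to the integral
    that dominates it. *)
Lemma additive_remainder (nu : set T -> R) (F : nat -> set T) U n :
  (forall A B, measurable A -> measurable B -> A `&` B = set0 ->
     nu (A `|` B) = nu A + nu B) ->
  (forall i, measurable (F i)) -> trivIset setT F -> measurable U ->
  (forall i, F i `<=` U) ->
  nu U = \sum_(i < n) nu (F i) + nu (U `\` \big[setU/set0]_(i < n) F i).
Proof.
move=> nuD mF tF mU FU; elim: n => [|n IH].
  by rewrite !big_ord0 setD0 add0r.
rewrite IH !big_ord_recr/= -addrA; congr (_ + _).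
rewrite -setDDl -nuD//; last 2 first.
- by apply: measurableD => //; apply: measurableD => //; exact: bigsetU_measurable.
- by rewrite setIC setDKI.
rewrite setDUK// => t Fnt; split; first exact: FU Fnt.
move=> Ut; have := @trivIset_bigsetUI _ predT F.
move=> /(_ (sub_trivIset _ tF) n n isT (leqnn _)).
by move=> /(_ (fun _ _ => I))/seteqP[/(_ t) + _]; apply; split.
Qed.

(** Domination by the integral of [g] is used twice: it makes the remainders of [nu] vanish, giving
    sigma-additivity, and it gives absolute continuity. Then the Radon-Nikodym theorem applies. *)
Lemma additive_density (nu : set T -> R) (g : T -> R) :
  mu.-integrable setT (EFin \o g) ->
  (forall A B, measurable A -> measurable B -> A `&` B = set0 ->
     nu (A `|` B) = nu A + nu B) ->
  (forall A, measurable A -> `|nu A| <= \int[mu]_(t in A) g t) ->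
  exists h : T -> R, mu.-integrable setT (EFin \o h) /\
    forall A, measurable A -> \int[mu]_(t in A) h t = nu A.
Proof.
move=> ig nuD nug; pose N A := (nu A)%:E.
have nu0 : nu set0 = 0.
  have := nuD _ _ measurable0 measurable0 (setI0 _); rewrite setU0; lra.
have gD A B : measurable A -> measurable B -> A `&` B = set0 ->
    \int[mu]_(t in A `|` B) g t = \int[mu]_(t in A) g t + \int[mu]_(t in B) g t.
  move=> mA mB AB; apply: Rintegral_setU => //; last exact/disj_set2P.
  by apply: integrableS ig => //; exact: measurableU.
have N_sigma_additive : semi_sigma_additive N.
  move=> F mF tF mU; set U := \bigcup_n F n.
  have FU i : F i `<=` U by exact: bigcup_sup.
  have : (\sum_(0 <= i < n) induced_charge ig (F i))%E @[n --> \oo]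
      --> induced_charge ig U by exact: charge_semi_sigma_additive.
  have gfin A : measurable A -> induced_charge ig A = (\int[mu]_(t in A) g t)%:E.
    move=> mA; rewrite fineK//; apply: integrable_fin_num => //.
    exact: integrableS ig.
  rewrite gfin//; rewrite (_ : (fun n => _) =
      EFin \o (fun n => \sum_(i < n) \int[mu]_(t in F i) g t)); last first.
    apply/funext => n /=; rewrite big_mkord -sumEFin.
    by apply: eq_bigr => i _; exact: gfin.
  move=> /fine_cvg gcvg.
  rewrite (_ : (fun n => _) = EFin \o (fun n => \sum_(i < n) nu (F i))); last first.
    by apply/funext => n /=; rewrite big_mkord -sumEFin.
  apply: cvg_EFin; first exact: nearW.
  apply/cvgrPdist_lt => e e0; move/cvgrPdist_lt : gcvg => /(_ e e0).
  apply: filterS => n /=; apply: le_lt_trans.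
  have mR : measurable (U `\` \big[setU/set0]_(i < n) F i).
    by apply: measurableD => //; exact: bigsetU_measurable.
  rewrite (additive_remainder n nuD mF tF mU FU).
  rewrite (additive_remainder n gD mF tF mU FU).
  rewrite !(addrC (\sum_(i < n) _)) !addrK.
  by apply: (le_trans (nug _ mR)); exact: ler_norm.
pose M := isCharge.Build _ _ _ N (congr1 EFin nu0) (fun A _ => erefl) N_sigma_additive.
pose C : {charge set T -> \bar R} := HB.pack N M.
have Cmu : C `<< mu.
  move=> Z Z0 A mA AZ; have muA0 := Z0 A mA AZ.
  change (N A = 0%:E); congr (_ %:E); apply/eqP; rewrite -normr_le0; apply: (le_trans (nug _ mA)).
  rewrite /Rintegral null_set_integral//.
  by apply: (measurable_int mu); exact: integrableS ig.
pose h := fine \o Radon_Nikodym C mu.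
have hE : EFin \o h = Radon_Nikodym C mu.
  by apply/funext => t; rewrite /= fineK// Radon_Nikodym_fin_num.
exists h; rewrite hE; split; first exact: Radon_Nikodym_integrable.
move=> A mA; rewrite /Rintegral.
rewrite -[X in fine X]/(\int[mu]_(x in A) (EFin \o h) x)%E hE.
by rewrite -Radon_Nikodym_integral.
Qed.

End MeasureLemmas.

(** * Simple dual-valued functions and the densities obtained from Hahn-Banach *)

Section Densities.
Context {R : realType} {X : lmodType R} (p : nat -> X -> R).
Context d (T : measurableType d) (mu : {sigma_finite_measure set T -> \bar R}).
Variables (I : set T) (G : T -> set X).
Hypothesis mI : measurable I.
Hypothesis ckG : forall t, I t -> ck p (G t).
Hypothesis sigma_integrable : forall f, fdual p f ->
  mu.-integrable I (fun t => (sigma f (G t))%:E).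

(** The simple functions with values in the dual. The sets [A] may overlap, so sums are formed by
    appending terms, without refining partitions. *)
Inductive simple_dual : (T -> X -> R) -> Prop :=
| simple_dual0 : simple_dual (fun _ _ => 0)
| simple_dual_cons A y phi : measurable A -> fdual p y -> simple_dual phi ->
    simple_dual (fun t x => \1_A t * y x + phi t x).

Lemma simple_dual_lin (a : R) (phi psi : T -> X -> R^o) :
  simple_dual phi -> simple_dual psi -> simple_dual (a *: phi + psi).
Proof.
move=> sphi spsi; elim: sphi => [|A y {}phi mA dy _ IH].
  rewrite (_ : _ + psi = psi)//; apply/funext => t; apply/funext => x.
  by change (a * 0 + psi t x = psi t x); rewrite mulr0 add0r.
rewrite (_ : _ + psi = (fun t x => \1_A t * (a * y x) + (a *: phi + psi) t x)).
  by apply: simple_dual_cons => //; exact: fdual_scale.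
apply/funext => t; apply/funext => x.
change (a * (\1_A t * y x + phi t x) + psi t x =
  \1_A t * (a * y x) + (a * phi t x + psi t x)); ring.
Qed.

Lemma simple_dual_fdual phi t : simple_dual phi -> fdual p (phi t).
Proof.
elim=> [|A y {}phi _ dy _ IH]; first exact: fdual0.
exact: fdual_affine.
Qed.

Lemma simple_dual_indic A y : measurable A -> fdual p y ->
  simple_dual (fun t x => \1_A t * y x).
Proof.
move=> mA dy; have := simple_dual_cons mA dy simple_dual0.
by rewrite (_ : (fun t x => _ + 0) = (fun t x => \1_A t * y x))//;
  apply/funext => t; apply/funext => x; rewrite addr0.
Qed.

(** The support function is not additive in the functional, so the induction runs over all constant
    terms [z]: on [A] the new term is absorbed into [z], off [A] it disappears. *)
Lemma simple_dual_integrable_add phi z : simple_dual phi -> fdual p z ->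
  mu.-integrable I (fun t => (sigma (fun x => z x + phi t x) (G t))%:E).
Proof.
move=> sphi; elim: sphi z => [|A y {}phi mA dy sphi IH] z dz.
  by under eq_fun do under [X in sigma X]eq_fun do rewrite addr0; exact: sigma_integrable.
pose u1 t := (sigma (fun x => z x + y x + phi t x) (G t))%:E.
pose u0 t := (sigma (fun x => z x + phi t x) (G t))%:E.
have iu1 : mu.-integrable I (u1 \_ A).
  apply/integrable_restrict => //; apply: (integrableS mI) => //.
    exact: measurableI.
  by apply: IH; exact: fdualD.
have iu0 : mu.-integrable I (u0 \_ (~` A)).
  have mA' := measurableC mA.
  apply/integrable_restrict => //; apply: (integrableS mI) => //.
    exact: measurableI.
  exact: IH.
apply: (eq_integrable mI (u1 \_ A \+ u0 \_ (~` A))%E); last exact: integrableD.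
move=> t _ /=; rewrite !patchE in_setC; case: (boolP (t \in A)) => tA /=.
  rewrite adde0 /u1; congr (sigma _ _)%:E; apply/funext => x.
  by rewrite indicE tA mul1r addrA.
rewrite add0e /u0; congr (sigma _ _)%:E; apply/funext => x.
by rewrite indicE (negbTE tA) mul0r add0r.
Qed.

Lemma simple_dual_integrable phi : simple_dual phi ->
  mu.-integrable I (fun t => (sigma (phi t) (G t))%:E).
Proof.
move=> sphi; have := simple_dual_integrable_add sphi (fdual0 p).
by under eq_fun do under [X in sigma X]eq_fun do rewrite add0r.
Qed.

Lemma sublinear_sigma_integral : @sublinear_on R (T -> X -> R^o) simple_dual
  (fun phi => \int[mu]_(t in I) sigma (phi t) (G t)).
Proof.
split=> [phi psi sphi spsi|c phi c0 sphi].
  have iphi := simple_dual_integrable sphi; have ipsi := simple_dual_integrable spsi.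
  rewrite -RintegralD//; apply: le_Rintegral => //.
  - have := simple_dual_integrable (simple_dual_lin 1 sphi spsi).
    by rewrite scale1r.
  - exact: (integrableD mI iphi ipsi).
  - move=> t It; have [G0 cG _] := ckG It.
    by apply: (sigmaD G0 cG); exact/fdual_fcont/simple_dual_fdual.
have iphi := simple_dual_integrable sphi.
rewrite -RintegralZl//; apply: le_Rintegral => //.
- have := simple_dual_integrable (simple_dual_lin c sphi simple_dual0).
  by rewrite (_ : c *: phi + _ = c *: phi)//;
    apply/funext => t; apply/funext => x; exact: addr0.
- exact: (integrableZl mI c iphi).
- move=> t It; have [G0 cG _] := ckG It.
  by apply: (sigmaZ c0 G0 cG); exact/fdual_fcont/simple_dual_fdual.
Qed.

Lemma Rintegral_sigma_indic A y : measurable A -> fdual p y ->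
  \int[mu]_(t in I) sigma (fun x => \1_A t * y x) (G t) =
  \int[mu]_(t in A `&` I) sigma y (G t).
Proof.
move=> mA dy; rewrite Rintegral_mkcondl; apply: eq_Rintegral => t /set_mem It.
rewrite patchE indicE; case: (t \in A).
  by congr (sigma _ _); apply/funext => x; rewrite mul1r.
(* Off [A] the functional is 0, and its support function is 0 because [G t] is nonempty. *)
under eq_fun do rewrite mul0r; have [[x Gx] cG _] := ckG It.
apply/eqP; rewrite eq_le sigma_le//=; last by exists x.
exact: (sigma_ge cG (fdual_fcont (fdual0 p)) Gx).
Qed.

(* The functional [chi_E y |-> y x] is dominated by the sublinear functional
   [phi |-> int_I sigma (phi t) (G t)]; a Hahn-Banach extension L to all simple
   X*-valued functions yields the X-valued measure [A |-> L (chi_A _)]. *)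
Lemma exists_selection_measure E x : measurable E -> E `<=` I ->
  (forall y, fdual p y -> y x <= \int[mu]_(t in E) sigma y (G t)) ->
  exists nu : (X -> R) -> set T -> R,
  [/\ forall (a : R) y z A, fdual p y -> fdual p z -> measurable A ->
        nu (fun x => a * y x + z x) A = a * nu y A + nu z A,
      forall y A B, fdual p y -> measurable A -> measurable B -> A `&` B = set0 ->
        nu y (A `|` B) = nu y A + nu y B,
      forall y A, fdual p y -> measurable A ->
        nu y A <= \int[mu]_(t in A `&` I) sigma y (G t) &
      forall y, fdual p y -> nu y E = y x].
Proof.
move=> mE EI xE.
(* Indexing the graph by [y] makes it unnecessary to show beforehand that [\1_E t * y] determines
   [y x]; domination forces this. *)
pose w (y : {y | fdual p y}) : T -> X -> R^o := fun t x' => \1_E t * sval y x'.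
pose c (y : {y | fdual p y}) := sval y x.
have [|||L [Llin LQ Lw]] := hahn_banach simple_dual_lin simple_dual0 (w := w) (c := c)
  (exist _ _ (fdual0 p)) sublinear_sigma_integral.
- by move=> [y dy]; exact: simple_dual_indic.
- move=> [y dy] /=; rewrite Rintegral_sigma_indic//.
  by rewrite (setIidl EI); exact: xE.
- move=> a [y dy] [z dz].
  exists (exist _ _ (fdual_affine a dy dz)); split => //.
  apply/funext => t; apply/funext => x'.
  change (\1_E t * (a * y x' + z x') = a * (\1_E t * y x') + \1_E t * z x'); ring.
pose ind A (y : X -> R) : T -> X -> R^o := fun t x => \1_A t * y x.
exists (fun y A => L (ind A y)); split.
- move=> a y z A dy dz mA; rewrite -Llin; [|exact: simple_dual_indic..].
  congr L; apply/funext => t; apply/funext => x'.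
  change (\1_A t * (a * y x' + z x') = a * (\1_A t * y x') + \1_A t * z x'); ring.
- move=> y A B dy mA mB AB.
  have := Llin 1 (ind A y) (ind B y) (simple_dual_indic mA dy) (simple_dual_indic mB dy).
  rewrite mul1r scale1r => <-; congr L; apply/funext => t; apply/funext => x'.
  change (\1_(A `|` B) t * y x' = \1_A t * y x' + \1_B t * y x').
  rewrite -mulrDl !indicE in_setU; case: (boolP (t \in A)) => tA; last by rewrite add0r.
  case: (boolP (t \in B)) => tB; last by rewrite addr0.
  have ABt : (A `&` B) t by split; exact/set_mem.
  by move: ABt; rewrite AB.
- move=> y A dy mA; apply: (le_trans (LQ _ (simple_dual_indic mA dy))).
  by rewrite Rintegral_sigma_indic.
- by move=> y dy; exact: (Lw (exist _ y dy)).
Qed.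

(** Each functional gets its density separately, so linearity in [y] is available only for
    integrals. *)
Lemma exists_density_family E x : measurable E -> E `<=` I ->
  (forall y, fdual p y -> y x <= \int[mu]_(t in E) sigma y (G t)) ->
  exists h : (X -> R) -> T -> R,
  [/\ forall y, fdual p y -> mu.-integrable I (EFin \o h y),
      forall (a : R) y z A, fdual p y -> fdual p z -> measurable A -> A `<=` I ->
        \int[mu]_(t in A) h (fun x => a * y x + z x) t =
        a * \int[mu]_(t in A) h y t + \int[mu]_(t in A) h z t,
      forall y A, fdual p y -> measurable A -> A `<=` I ->
        \int[mu]_(t in A) h y t <= \int[mu]_(t in A) sigma y (G t) &
      forall y, fdual p y -> \int[mu]_(t in E) h y t = y x].
Proof.
move=> mE EI xE.
have [nu [nulin nuD nule nuE]] := exists_selection_measure mE EI xE.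
have nu_opp y A : fdual p y -> measurable A -> nu (fun x => - 1 * y x) A = - nu y A.
  move=> dy mA; have d0 := fdual0 p.
  have nu0 : nu (fun _ => 0) A = 0.
    have := nulin (- 1) _ _ A d0 d0 mA.
    by under [X in nu X]eq_fun do rewrite mulr0 addr0; rewrite mulN1r addNr.
  have := nulin (- 1) _ _ A dy d0 mA.
  by under [X in nu X]eq_fun do rewrite addr0; rewrite nu0 mulN1r addr0.
have /choice[h hh] y : exists h : T -> R, fdual p y ->
    mu.-integrable setT (EFin \o h) /\
    forall A, measurable A -> \int[mu]_(t in A) h t = nu y A.
  have [dy|] := pselect (fdual p y); last by exists (fun=> 0).
  (* The integral of [sigma y] bounds [nu y A] from above, and that of [sigma] at [- y] bounds it
     from below; [sy] dominates both. *)
  pose sy t := `|sigma y (G t)| + `|sigma (fun x => - 1 * y x) (G t)|.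
  have dNy := fdual_scale (- 1) dy.
  have isy : mu.-integrable I (EFin \o sy).
    have i1 := integrable_norm (sigma_integrable dy).
    have i2 := integrable_norm (sigma_integrable dNy).
    exact: (integrableD mI i1 i2).
  have [|A B mA mB|A mA|h [ih hE]] := @additive_density _ _ _ mu (nu y) (sy \_ I).
  - by rewrite -restrict_EFin; apply/(integrable_mkcond (EFin \o sy) mI).
  - exact: nuD.
  - rewrite -Rintegral_mkcondr.
    have iA : mu.-integrable (A `&` I) (EFin \o sy).
      by apply: integrableS isy => //; exact: measurableI.
    have le y' : fdual p y' -> (forall t, `|sigma y' (G t)| <= sy t) ->
        nu y' A <= \int[mu]_(t in A `&` I) sy t.
      move=> dy' hy'; apply: (le_trans (nule _ _ dy' mA)); apply: le_Rintegral => //.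
      + exact: measurableI.
      + apply: (integrableS mI) => //; [exact: measurableI|exact: sigma_integrable].
      + by move=> t _; rewrite (le_trans (ler_norm _)).
    rewrite ler_norml lerNl -nu_opp// !le// => t; rewrite /sy.
    + by rewrite lerDl.
    + by rewrite lerDr.
  - by exists h.
exists h; split.
- by move=> y dy; apply: integrableS (hh y dy).1.
- move=> a y z A dy dz mA AI.
  by rewrite (hh _ (fdual_affine a dy dz)).2// (hh _ dy).2// (hh _ dz).2// nulin.
- by move=> y A dy mA AI; rewrite (hh _ dy).2// -{2}(setIidl AI) nule.
- by move=> y dy; rewrite (hh _ dy).2// nuE.
Qed.

End Densities.

(** * Integrals of combinations and of almost everywhere related functions *)

Section IntegralLemmas.
Context d (T : measurableType d) {R : realType}.
Variable mu : {measure set T -> \bar R}.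

Lemma integrable_comb A m (a : 'I_m -> R) (u : 'I_m -> T -> R) : measurable A ->
  (forall k, mu.-integrable A (EFin \o u k)) ->
  mu.-integrable A (EFin \o (fun t => \sum_k a k * u k t)) /\
  \int[mu]_(t in A) (\sum_k a k * u k t) = \sum_k a k * \int[mu]_(t in A) u k t.
Proof.
move=> mA; elim: m a u => [a u _|m IH a u iu].
  rewrite big_ord0 (_ : (fun t => _) = cst 0); last first.
    by apply/funext => t; rewrite big_ord0.
  by split; [exact: integrable0|rewrite /Rintegral integral0].
have [iv ve] := IH (fun k => a (lift ord0 k)) _ (fun k => iu (lift ord0 k)).
have i0 : mu.-integrable A (EFin \o (fun t => a ord0 * u ord0 t)).
  exact: (integrableZl mA (a ord0) (iu ord0)).
rewrite (_ : (fun t => _) = (fun t => a ord0 * u ord0 t +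
    \sum_(k < m) a (lift ord0 k) * u (lift ord0 k) t)); last first.
  by apply/funext => t; rewrite big_ord_recl.
rewrite big_ord_recl -ve -RintegralZl// -RintegralD//; split => //.
exact: (integrableD mA i0 iv).
Qed.

(** Completeness carries measurability across almost everywhere equality; thus [y (g t)] inherits
    integrability from its density. *)
Lemma ae_eq_integrable D (f g : T -> \bar R) : measure_is_complete mu ->
  measurable D -> ae_eq mu D f g -> mu.-integrable D f -> mu.-integrable D g.
Proof.
move=> cmu mD fg /integrableP[mf foo].
have mg := ae_measurable_fun cmu fg mf; apply/integrableP; split => //.
rewrite -(ae_eq_integral (abse \o g) (abse \o f))//.
- exact: measurableT_comp.
- exact: measurableT_comp.
- exact: ae_eq_abse.
Qed.

Lemma le_integral_ae D (f g : T -> \bar R) : measurable D ->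
  mu.-integrable D f -> mu.-integrable D g ->
  {ae mu, forall t, D t -> (f t <= g t)%E} ->
  (\int[mu]_(t in D) f t <= \int[mu]_(t in D) g t)%E.
Proof.
move=> mD iF iG [N [mN N0 hN]].
rewrite (negligible_integral mN mD iF N0) (negligible_integral mN mD iG N0).
have mDN : measurable (D `\` N) by exact: measurableD.
apply: le_integral => //.
- by apply: integrableS iF => //; exact: subDsetl.
- by apply: integrableS iG => //; exact: subDsetl.
- move=> t /set_mem[Dt nNt]; apply: contrapT => fg; apply: nNt; apply: hN.
  by move=> /(_ Dt).
Qed.

End IntegralLemmas.

Lemma fdual_comb_morph (R : realType) (X : lmodType R) (p : nat -> X -> R)
    (F : (X -> R) -> R) :
  (forall (a : R) y z, fdual p y -> fdual p z ->
    F (fun x => a * y x + z x) = a * F y + F z) ->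
  forall m (a : 'I_m -> R) (y : 'I_m -> X -> R), (forall k, fdual p (y k)) ->
    F (fun x => \sum_k a k * y k x) = \sum_k a k * F (y k).
Proof.
move=> Flin; elim=> [|m IH] a y dy.
  under eq_fun do rewrite big_ord0; rewrite big_ord0.
  have := Flin (- 1) _ _ (fdual0 p) (fdual0 p).
  by under [X in F X]eq_fun do rewrite mulr0 addr0; rewrite mulN1r addNr.
under eq_fun do rewrite big_ord_recl; rewrite big_ord_recl.
rewrite -(IH (fun k => a (lift ord0 k)) (fun k => y (lift ord0 k)))// -Flin//.
exact: (fdual_comb (fun k => a (lift ord0 k))).
Qed.

(** * From densities to a selection *)

Section Selections.
Context {R : realType} {X : lmodType R} (p : nat -> X -> R).
Context d (T : measurableType d) (mu : {sigma_finite_measure set T -> \bar R}).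
Variables (I : set T) (G : T -> set X) (h : (X -> R) -> T -> R).
Hypothesis mI : measurable I.
Hypothesis ckG : forall t, I t -> ck p (G t).
Hypothesis sigma_integrable : forall f, fdual p f ->
  mu.-integrable I (fun t => (sigma f (G t))%:E).
Hypothesis h_integrable : forall y, fdual p y -> mu.-integrable I (EFin \o h y).
Hypothesis h_lin : forall (a : R) y z A,
  fdual p y -> fdual p z -> measurable A -> A `<=` I ->
  \int[mu]_(t in A) h (fun x => a * y x + z x) t =
  a * \int[mu]_(t in A) h y t + \int[mu]_(t in A) h z t.
Hypothesis h_le : forall y A, fdual p y -> measurable A -> A `<=` I ->
  \int[mu]_(t in A) h y t <= \int[mu]_(t in A) sigma y (G t).

(** The moment condition in integrated form. It is localised to almost every [t], and it also yields
    the Pettis integrals of the selection. *)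
Lemma comb_Rintegral_density A m (a : 'I_m -> R) (y : 'I_m -> X -> R) :
  measurable A -> A `<=` I -> (forall k, fdual p (y k)) ->
  \sum_k a k * \int[mu]_(t in A) h (y k) t <=
  \int[mu]_(t in A) sigma (fun x => \sum_k a k * y k x) (G t).
Proof.
move=> mA AI dy.
rewrite -(fdual_comb_morph (p := p) (F := fun y => \int[mu]_(t in A) h y t))//.
  by apply: h_le => //; exact: fdual_comb.
by move=> b u v du dv; exact: h_lin.
Qed.

(** There are only countably many rational combinations of the [f j], so one null set serves for all
    inequalities; outside it the least-squares lemma applies in [G t]. *)
Lemma ae_exists_moment_point (J : countType) (f : J -> X -> R) :
  (forall j, fdual p (f j)) ->
  {ae mu, forall t, I t -> exists2 x, G t x & forall j, f j x = h (f j) t}.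
Proof.
move=> df.
pose code := {m : nat & ({ffun 'I_m -> J} * {ffun 'I_m -> rat})%type}.
have : {ae mu, forall t, forall c : code, I t ->
    \sum_k ratr ((projT2 c).2 k) * h (f ((projT2 c).1 k)) t <=
    sigma (fun x => \sum_k ratr ((projT2 c).2 k) * f ((projT2 c).1 k) x) (G t)}.
  apply: ae_forall_countable => -[m [s q]] /=.
  have ih k : mu.-integrable I (EFin \o h (f (s k))) by exact: h_integrable.
  apply: ae_le_of_Rintegral_le => //.
  - exact: (integrable_comb (fun k => ratr (q k)) mI ih).1.
  - by apply: sigma_integrable; exact: (fdual_comb (fun k => ratr (q k))).
  - move=> A mA AI.
    have ihA k : mu.-integrable A (EFin \o h (f (s k))) by exact: integrableS (ih k).
    by rewrite (integrable_comb (fun k => ratr (q k)) mA ihA).2 comb_Rintegral_density.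
apply: filterS => t ht It; have [G0 cG _] := ckG It.
apply: (exists_moment_point (ckG It) df) => m s a.
apply: (rational_comb_le_sigma G0 cG (y := fun k => f (s k)) (z := fun k => h (f (s k)) t)) => // q.
have := ht (existT _ m ([ffun k => s k], [ffun k => q k])) It.
rewrite /=; under eq_bigr do rewrite !ffunE.
by under [X in sigma X]eq_fun do under eq_bigr do rewrite !ffunE.
Qed.

Lemma exists_selection_of_densities (J : countType) (f : J -> X -> R) :
  (forall j, fdual p (f j)) ->
  {ae mu, forall t, I t ->
    forall x y, G t x -> G t y -> (forall j, f j x = f j y) -> x = y} ->
  exists2 g : T -> X, {ae mu, forall t, I t -> G t (g t)} &
    forall y, fdual p y -> {ae mu, forall t, I t -> y (g t) = h y t}.
Proof.
move=> df fsep.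
(* The point [g t] is selected through the countable family alone, before any other functional is
   considered. *)
have /choice[g hg] t : exists x, (exists2 x, G t x & forall j, f j x = h (f j) t) ->
    G t x /\ forall j, f j x = h (f j) t.
  have [[x Gx fx]|nx] := pselect (exists2 x, G t x & forall j, f j x = h (f j) t).
    by exists x.
  by exists 0 => /nx.
have ae_f := ae_exists_moment_point df; exists g.
  by move: ae_f; apply: filterS => t ht It; exact: (hg t (ht It)).1.
move=> y dy.
(* With [y] adjoined as [None], some point of [G t] matches [y] as well; the separating family
   identifies it with [g t], outside a null set depending on [y]. *)
pose f' (j : option J) := if j is Some j then f j else y.
have df' j : fdual p (f' j) by case: j.
have := ae_exists_moment_point df'.
move: fsep ae_f; apply: filterS3 => t sep ht ht' It.
have [Gg fg] := hg t (ht It); have [x Gx fx] := ht' It.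
rewrite (sep It (g t) x)//; first exact: (fx None).
by move=> j; rewrite fg; have := fx (Some j).
Qed.

End Selections.

(** * The two inclusions *)

Lemma fdual_separates (R : realType) (X : lmodType R) (p : nat -> X -> R) :
  frechet_seminorms p ->
  forall x y, (forall f, fdual p f -> f x = f y) -> x = y.
Proof.
move=> [sp _ sep _] x y fxy; apply/eqP; rewrite -subr_eq0; apply/eqP/sep => n.
have [f [df _ <-]] := exists_norming_functional sp n (x - y).
by rewrite -scaleN1r addrC df.1 (fxy _ df) mulN1r addNr.
Qed.

(** The least-squares lemma, with the whole dual as family and the values at [x] as targets, gives a
    point of [P] that no functional distinguishes from [x]. *)
Lemma integral_mem_ck (R : realType) (X : lmodType R) (p : nat -> X -> R) P (x : X) :
  frechet_seminorms p -> ck p P ->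
  (forall f, fdual p f -> f x <= sigma f P) -> P x.
Proof.
move=> fp ckP xP.
have [|m s a|x' Px' xx'] := @exists_moment_point _ _ p P {f | fdual p f} sval
    (fun f => sval f x) ckP.
- by case.
- by apply: (xP (fun x => \sum_k a k * sval (s k) x)); apply: fdual_comb => k; case: (s k).
- rewrite (fdual_separates fp (x := x) (y := x'))// => f df.
  exact/esym/(xx' (exist _ f df)).
Qed.

Theorem theorem4p11 (R : realType) (X : lmodType R) (p : nat -> X -> R)
  (G : R -> set X) :
  frechet_seminorms p ->
  (forall t, `[0%R, 1%R]%classic t -> ck p (G t)) ->
  bochner_measurable p G ->
  mf_pettis_integrable p G ->
  forall E : set (lebT R), measurable E -> E `<=` `[0%R, 1%R]%classic ->
  forall P : set X, mf_pettis_integral p G E P ->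
  P = [set x | exists g : R -> X,
                 [/\ pettis_integrable p g, selection G g & pettis_integral p g E x]].
Proof.
move=> fp ckG bG [iG PG] E mE EI P [ckP intP].
have [sp ndp sepp _] := fp.
pose I01 : set (lebT R) := `[0%R, 1%R]%classic.
have mI : measurable I01 by apply: sub_caratheodory; exact: measurable_itv.
have iGA A f : measurable A -> A `<=` I01 -> fdual p f ->
    leb.-integrable A (fun t => (sigma f (G t))%:E).
  by move=> mA AI df; exact: integrableS (iG f df).
apply/seteqP; split=> [x Px|x [g [[ig _] selg xg]]]; last first.
  apply: (integral_mem_ck fp ckP) => f df.
  rewrite -lee_fin -(xg f df) -(intP f df); apply: le_integral_ae => //.
  - exact: integrableS (ig f df).
  - exact: iGA.
  - move: selg; apply: filterS => t Gg Et.
    have [G0 cG _] := ckG _ (EI _ Et).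
    by rewrite lee_fin; apply: (sigma_ge cG (fdual_fcont df)); exact/Gg/EI.
(* Membership in [P] enters only as this domination, which is what Hahn-Banach requires. *)
have xE y : fdual p y -> y x <= \int[leb]_(t in E) sigma y (G t).
  move=> dy; rewrite /Rintegral intP//; have [_ cP _] := ckP.
  exact: (sigma_ge cP (fdual_fcont dy)).
have [h [ih hlin hle hE]] := exists_density_family mI ckG iG mE EI xE.
have [J [f [df fsep]]] := countable_separating_family sp ndp sepp ckG bG.
have [g selg gh] := exists_selection_of_densities mI ckG iG ih hlin hle df fsep.
(* As [g] comes from a pointwise choice, the measurability of [y (g t)] is obtained from the density
   by completeness. *)
have intg y A : fdual p y -> measurable A -> A `<=` I01 ->
    (\int[leb]_(t in A) (y (g t))%:E = (\int[leb]_(t in A) h y t)%:E)%E.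
  move=> dy mA AI; have ihA : leb.-integrable A (EFin \o h y) by exact: integrableS (ih y dy).
  rewrite fineK; last exact: integrable_fin_num.
  have gA : {ae leb, forall t, A t -> (h y t)%:E = (y (g t))%:E}.
    by move: (gh y dy); apply: filterS => t ht /AI It; rewrite ht.
  have mh : measurable_fun A (EFin \o h y) by exact: (measurable_int leb).
  apply/esym/ae_eq_integral => //.
  exact: (ae_measurable_fun completed_lebesgue_measure_is_complete gA).
exists g; split => //.
- split=> [y dy|A mA AI].
    apply: (ae_eq_integrable _ mI _ (ih y dy)).
      exact: completed_lebesgue_measure_is_complete.
    by move: (gh y dy); apply: filterS => t ht It /=; rewrite ht.
  (* The Pettis integral of [g] over [A] is found inside the compact convex set [PA], as a point
     whose values are the integrals of the densities. *)
  have [PA [ckPA intPA]] := PG A mA AI.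
  have [|m s a|z PAz hz] := @exists_moment_point _ _ p PA {f | fdual p f} sval
      (fun f => \int[leb]_(t in A) h (sval f) t) ckPA.
  - by case.
  - have ds k : fdual p (sval (s k)) by case: (s k).
    apply: (le_trans (comb_Rintegral_density hlin hle a mA AI ds)).
    rewrite /Rintegral intPA//.
    exact: (fdual_comb a ds).
  - by exists z => y dy; rewrite intg// -(hz (exist _ y dy)).
- by move=> y dy; rewrite intg// hE.
Qed.
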